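(* Let $\mathcal N$ be a finite, locally irreducible and strongly connected critical abelian network. (i) If $\mathcal N$ is an agent network, then $\mathrm{cap}(\mathcal N)=0$. (ii) If $\mathrm{cap}(\mathcal N)=0$ and all states of $\mathcal N$ are locally recurrent, then $\mathcal N$ is an agent network.
   Context: Abelian networks. $\mathbb N=\{0,1,2,\dots\}$. Let $G=(V,E)$ be a finite directed graph (self-loops and multiple edges allowed). An abelian network $\mathcal N$ on $G$ assigns to each $v\in V$ a nonempty input alphabet $A_v$ and a nonempty state space $Q_v$ (the $A_v$ pairwise disjoint), maps $T_a:Q_v\to Q_v$ for $a\in A_v$, and, for each edge $e$ from $v$ to $u$, a message-passing function $T_e:Q_v\times A_v\to A_u^*$ (free monoid of words), such that for all $v$, $a,b\in A_v$, $q\in Q_v$: $T_aT_b=T_bT_a$, and for every edge $e$ out of $v$ the words $T_e(q,a)T_e(T_a(q),b)$ and $T_e(q,b)T_e(T_b(q),a)$ agree up to permuting letters. Put $A=\bigsqcup_v A_v$, $Q=\prod_v Q_v$; $\mathcal N$ is finite if $A$ and $Q$ are finite. For a word $w\in A^*$, $|w|\in\mathbb N^A$ counts the occurrences of each letter. For $a\in A_v$, $\mathbf q\in Q$: $t_a\mathbf q$ is $\mathbf q$ with $\mathbf q(v)$ replaced by $T_a(\mathbf q(v))$, and $\mathbf M_a(\mathbf q)=\sum_{e\text{ out of }v}|T_e(\mathbf q(v),a)|\in\mathbb N^A$. A configuration is a pair $\mathbf x.\mathbf q$ with $\mathbf x\in\mathbb Z^A$, $\mathbf q\in Q$; $\pi_a(\mathbf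 x.\mathbf q)=(\mathbf x+\mathbf M_a(\mathbf q)-|a|).t_a\mathbf q$. For $w=a_1\cdots a_\ell$: $t_w=t_{a_\ell}\cdots t_{a_1}$, $\mathbf M_w(\mathbf q)=\sum_i\mathbf M_{a_i}(t_{a_1\cdots a_{i-1}}\mathbf q)$, $\pi_w=\pi_{a_\ell}\cdots\pi_{a_1}$; these depend only on $|w|$, so $t_{\mathbf n},\mathbf M_{\mathbf n},\pi_{\mathbf n}$ are defined for $\mathbf n\in\mathbb N^A$. The word $w$ is legal for $\mathbf x.\mathbf q$ if, with $\mathbf x_i.\mathbf q_i=\pi_{a_1\cdots a_i}(\mathbf x.\mathbf q)$, $\mathbf x_{i-1}(a_i)\ge1$ for all $1\le i\le\ell$. Write $\mathbf x.\mathbf q\to\mathbf x'.\mathbf q'$ if $\pi_w(\mathbf x.\mathbf q)=\mathbf x'.\mathbf q'$ for some (possibly empty) word $w$ legal for $\mathbf x.\mathbf q$. Local recurrence, kernel, production matrix. $\mathcal N$ is locally irreducible if for all $\mathbf q,\mathbf q'\in Q$ there are words $w,w'$ with $t_w\mathbf q=t_{w'}\mathbf q'$. For $\mathcal N$ finite, let $e$ be the product of all idempotents of the finite commutative monoid generated by the $t_a$ in $\mathrm{End}(Q)$; $\mathrm{Loc}(\mathcal N)=eQ$ is the set of locally recurrent states. The total kernel is $K=\{\mathbf z\in\mathbb Z^A: t_{\mathbf z^+}\mathbf q=t_{\mathbf z^-}\mathbf q\ \forall\mathbf q\in\mathrm{Loc}(\mathcal N)\}$, with $\mathbf z^{\pm}\in\mathbb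 N^A$ the positive/negative parts of $\mathbf z$. For $\mathcal N$ finite and locally irreducible, the production matrix $P$ is the unique rational $A\times A$ matrix with $P\mathbf k=\mathbf M_{\mathbf k}(\mathbf q)$ for all $\mathbf k\in K\cap\mathbb N^A$ and $\mathbf q\in\mathrm{Loc}(\mathcal N)$. $\mathcal N$ is critical if the spectral radius of $P$ is $1$, and strongly connected if the digraph on $A$ with an edge $(a,b)$ whenever $P_{ba}>0$ is strongly connected. Agent networks and capacity. An agent network is an abelian network with $\sum_{b\in A}\mathbf M_a(\mathbf q)(b)=1$ for all $a\in A$, $\mathbf q\in Q$. For critical strongly connected $\mathcal N$, the exchange rate vector $\mathbf s$ is the unique positive integer vector with $\mathbf s^\top P=\mathbf s^\top$ and $\gcd_a\mathbf s(a)=1$. A configuration $\mathbf x.\mathbf q$ halts if $\mathbf x.\mathbf q\to\mathbf x'.\mathbf q'$ for some $\mathbf x'\le\mathbf 0$. The capacity of a state is $\mathrm{cap}(\mathbf q)=\sup\{\mathbf s^\top\mathbf z:\mathbf z\in\mathbb Z^A,\ \mathbf z.\mathbf q\text{ halts}\}$ and the capacity of $\mathcal N$ is $\mathrm{cap}(\mathcal N)=\max_{\mathbf q\in Q}\mathrm{cap}(\mathbf q)$. *)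

(* Defs.v *)
From HB Require Import structures.
From mathcomp Require Import all_boot all_order all_algebra all_field.
From mathcomp Require Import boolp classical_sets constructive_ereal.

Set Implicit Arguments.
Unset Strict Implicit.
Unset Printing Implicit Defensive.

Import Order.TTheory GRing.Theory Num.Theory.
Local Open Scope ring_scope.

(* A finite abelian network. The edges of the underlying multigraph are given
   by the finite set [edge v u] of edges from v to u, for all v and u (self-loops
   and multiple edges allowed). The pairwise disjoint alphabets are the fibres
   of the disjoint union [letter] below. Finiteness of A and Q amounts to
   finiteness of every A_v and (the Q_v being nonempty) of every Q_v. *)
Record finite_abelian_network := FiniteAbelianNetwork {
  vertex : finType;
  edge : vertex -> vertex -> finType;
  alphabet : vertex -> finType;
  local_state : vertex -> finType;
  transition : forall v, alphabet v -> local_state v -> local_state v;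
  message : forall v u, edge v u ->
    local_state v -> alphabet v -> seq (alphabet u);
  alphabet_gt0 : forall v, (0 < #|alphabet v|)%N;
  local_state_gt0 : forall v, (0 < #|local_state v|)%N;
  transitionC : forall v (a b : alphabet v) (q : local_state v),
    transition a (transition b q) = transition b (transition a q);
  messageC : forall v u (e : edge v u) (a b : alphabet v) (q : local_state v),
    perm_eq (message e q a ++ message e (transition a q) b)
            (message e q b ++ message e (transition b q) a)
}.

Section Network.
Variable N : finite_abelian_network.

Definition letter : finType := {v : vertex N & alphabet v}.
Definition state : finType := {dffun forall v : vertex N, local_state v}.
Definition config : Type := ({ffun letter -> int} * state)%type.

Implicit Types (a b : letter) (w : seq letter) (q : state) (c : config).
Implicit Types (n k : {ffun letter -> nat}) (z : {ffun letter -> int}).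

Definition step a q : state :=
  [ffun u => dfwith q (transition (tagged a) (q (tag a))) u].

Definition step_msg a q : {ffun letter -> nat} :=
  [ffun b => \sum_(u : vertex N) \sum_(e : edge (tag a) u)
     count_mem b [seq Tagged (@alphabet N) x
                 | x <- message e (q (tag a)) (tagged a)]]%N.

Definition fire a c : config :=
  ([ffun b => c.1 b + (step_msg a c.2 b)%:Z - (b == a)%:Z], step a c.2).

(* In a word a_1 ... a_l the letter a_1 acts first. *)
Definition step_word w q : state := foldl (fun q' a => step a q') q w.

Fixpoint msg_word w q : {ffun letter -> nat} :=
  if w is a :: w' then [ffun b => step_msg a q b + msg_word w' (step a q) b]%N
  else [ffun=> 0%N].

Definition fire_word w c : config := foldl (fun c' a => fire a c') c w.

Fixpoint legal w c : bool :=
  if w is a :: w' then (1 <= c.1 a) && legal w' (fire a c) else true.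

Lemma stepC a b q : step a (step b q) = step b (step a q).
Proof.
apply/ffunP => u; rewrite !ffunE.
case: a b => [v a] [v' b] /=; case: (eqVneq v v') => [vv'|vv'].
  subst v'; case: (eqVneq v u) => [<-|vu].
    by rewrite !dfwith_in transitionC.
  by rewrite !dfwith_out // !ffunE !dfwith_out.
have v'v : v' != v by rewrite eq_sym.
rewrite (dfwith_out q _ vv') (dfwith_out q _ v'v).
case: (eqVneq v u) => [<-|vu].
  by rewrite dfwith_in dfwith_out // ffunE dfwith_in.
rewrite dfwith_out // ffunE.
case: (eqVneq v' u) => [<-|v'u]; first by rewrite !dfwith_in.
by rewrite !dfwith_out // ffunE dfwith_out.
Qed.

Lemma step_msgC a b q d :
  (step_msg a q d + step_msg b (step a q) d =
   step_msg b q d + step_msg a (step b q) d)%N.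
Proof.
rewrite !ffunE; case: a b => [v a] [v' b] /=.
case: (eqVneq v v') => [vv'|vv'].
  subst v'; rewrite !dfwith_in -!big_split; apply: eq_bigr => u _.
  rewrite -!big_split; apply: eq_bigr => e _ /=.
  rewrite -!count_cat -!map_cat.
  by apply/permP/perm_map/messageC.
by rewrite addnC !dfwith_out // eq_sym.
Qed.

Lemma word_perm_ind (P : seq letter -> seq letter -> Prop) :
  (forall w, P w w) ->
  (forall w1 w2 w3, P w1 w2 -> P w2 w3 -> P w1 w3) ->
  (forall a w1 w2, P w1 w2 -> P (a :: w1) (a :: w2)) ->
  (forall a b w, P (a :: b :: w) (b :: a :: w)) ->
  forall w1 w2, perm_eq w1 w2 -> P w1 w2.
Proof.
move=> Pr Pt Pc Ps; elim=> [|a w1 IH] w2 pw.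
  by move: (perm_size pw); case: w2 pw.
have aw2 : a \in w2 by rewrite -(perm_mem pw) mem_head.
move: pw; have [s1 s2] := splitPr aw2; rewrite perm_sym -cat1s perm_catCA /= perm_cons.
rewrite perm_sym => /IH/(Pc a) H; apply: (Pt _ _ _ H).
elim: s1 {aw2 H} => [|b s1 IHs] //=.
exact: Pt (Ps _ _ _) (Pc _ _ _ IHs).
Qed.

Lemma step_word_perm w1 w2 q : perm_eq w1 w2 -> step_word w1 q = step_word w2 q.
Proof.
move=> pw; move: w1 w2 pw q.
apply: word_perm_ind => // [w1 w2 w3 H1 H2 q|a w1 w2 H q|a b w q] /=.
- by rewrite H1.
- exact: H.
- by rewrite /step_word /= stepC.
Qed.

Lemma msg_word_cons a w q d :
  msg_word (a :: w) q d = (step_msg a q d + msg_word w (step a q) d)%N.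
Proof. by rewrite [LHS]ffunE. Qed.

Lemma msg_word_perm w1 w2 q : perm_eq w1 w2 -> msg_word w1 q = msg_word w2 q.
Proof.
move=> pw; move: w1 w2 pw q.
apply: word_perm_ind => // [w1 w2 w3 H1 H2 q|a w1 w2 H q|a b w q].
- by rewrite H1.
- by apply/ffunP => d; rewrite !msg_word_cons H.
- by apply/ffunP => d; rewrite !msg_word_cons !addnA stepC step_msgC.
Qed.

Definition reaches c c' : Prop := exists2 w, legal w c & fire_word w c = c'.

(* t_n and M_n for n in N^A, computed along one word w with |w| = n; the choice
   of w is immaterial by [step_word_perm] and [msg_word_perm]. *)
Definition word_of n : seq letter := flatten [seq nseq (n a) a | a <- enum letter].
Lemma count_word_of n a : count_mem a (word_of n) = n a.
Proof.
rewrite /word_of count_flatten -map_comp sumnE big_map big_enum /=.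
rewrite (bigD1 a) //= count_nseq /= eqxx mul1n big1 ?addn0 // => b ba.
by rewrite count_nseq /= (negPf ba).
Qed.

Definition step_vec n q : state := step_word (word_of n) q.
Definition msg_vec n q : {ffun letter -> nat} := msg_word (word_of n) q.

Definition locally_irreducible : Prop :=
  forall q q', exists w w', step_word w q = step_word w' q'.

Definition endo_comp (f g : {ffun state -> state}) : {ffun state -> state} :=
  [ffun q => f (g q)].

Definition endo_id : {ffun state -> state} := [ffun q => q].

Definition submonoid (S : {set {ffun state -> state}}) : bool :=
  (endo_id \in S) && [forall f in S, forall g in S, endo_comp f g \in S].

Definition transition_monoid : {set {ffun state -> state}} :=
  \bigcap_(S : {set {ffun state -> state}} |
     submonoid S && [forall a, [ffun q => step a q] \in S]) S.

(* The monoid is commutative, so the order of the product is irrelevant. *)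
Definition max_idempotent : {ffun state -> state} :=
  \big[endo_comp/endo_id]_(f in transition_monoid | endo_comp f f == f) f.

Definition Loc : {set state} := [set max_idempotent q | q : state].

Definition pos_part z : {ffun letter -> nat} :=
  [ffun a => `|Num.max (z a) 0|%N].
Definition neg_part z : {ffun letter -> nat} :=
  [ffun a => `|Num.max (- z a) 0|%N].

Definition in_kernel z : Prop :=
  {in Loc, forall q, step_vec (pos_part z) q = step_vec (neg_part z) q}.

(* A x A matrices are indexed through the enumeration of the letters. *)
Definition entry (P : 'M[rat]_#|letter|) b a : rat :=
  P (enum_rank b) (enum_rank a).

Definition is_production_matrix (P : 'M[rat]_#|letter|) : Prop :=
  forall k, in_kernel [ffun a => (k a)%:Z] -> {in Loc, forall q b,
    \sum_a entry P b a * (k a)%:R = (msg_vec k q b)%:R}.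

(* Exists and is unique when N is locally irreducible. *)
Definition production_matrix : 'M[rat]_#|letter| :=
  xget 0 [set P | is_production_matrix P]%classic.

End Network.

(* The eigenvalues of a rational matrix are algebraic, so nothing is lost by
   ranging over algC. *)
Definition spectral_radius n (P : 'M[rat]_n) : algC :=
  @supremum _ algC 0
    [set r : algC | exists2 l : algC, eigenvalue (map_mx ratr P) l & `|l| = r]%classic.

Section CriticalNetwork.
Variable N : finite_abelian_network.

Implicit Types (a b : letter N) (q : state N) (z : {ffun letter N -> int}).

Definition critical : Prop := spectral_radius (production_matrix N) = 1.

Definition strongly_connected : Prop :=
  forall a b, connect (fun c d => 0 < entry (production_matrix N) d c) a b.

Definition agent_network : Prop :=
  forall a q, (\sum_b step_msg a q b)%N = 1%N.

Definition is_exchange_rate (s : {ffun letter N -> nat}) : Prop :=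
  [/\ forall a, (0 < s a)%N,
      forall a, \sum_b (s b)%:R * entry (production_matrix N) b a = (s a)%:R
    & (\big[gcdn/0]_a s a)%N = 1%N].

(* Exists and is unique when N is moreover critical and strongly connected. *)
Definition exchange_rate : {ffun letter N -> nat} :=
  xget [ffun=> 0%N] [set s | is_exchange_rate s]%classic.

Definition halts (c : config N) : Prop :=
  exists2 c', reaches c c' & forall a, c'.1 a <= 0.

Definition state_capacity q : \bar int :=
  supremum -oo%E
    [set (\sum_a (exchange_rate a)%:Z * z a)%:E | z in [set z | halts (z, q)]]%classic.

Definition capacity : \bar int :=
  \big[Order.max/-oo%E]_(q : state N) state_capacity q.

End CriticalNetwork.

(* Main.v *)
Require Import Defs.
From mathcomp Require Import all_boot all_order all_algebra all_field.
From mathcomp Require Import boolp classical_sets constructive_ereal.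
From mathcomp Require Import ring.

(* Firing a letter a in state q changes the weight s.x by s.M_a(q) - s(a), and
   these changes cancel along every cycle of t_a, because s^T P = s^T.
   An agent network has column sums of P equal to 1, so s = 1 and the weight is
   conserved: a configuration that halts has nonpositive weight.
   Conversely, if the capacity is 0 no firing loses weight, and when all states
   are locally recurrent every firing lies on a cycle, so no firing gains weight
   either.  A letter of minimal weight then emits a single letter, again of
   minimal weight; by strong connectivity s is constant, hence equal to 1, and
   every firing produces exactly one letter.
   That s exists is the Perron-Frobenius theorem.  Its analytic input is that a
   nonnegative matrix A without eigenvalues in [t0, +oo[ admits u > 0 with
   A u < t0 u; it is applied over the real closed field of real algebraic
   numbers. *)

Set Implicit Arguments.
Unset Strict Implicit.
Unset Printing Implicit Defensive.

Import Order.TTheory GRing.Theory Num.Theory.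
Local Open Scope ring_scope.

(** * Nonnegative matrices over a real closed field *)

Lemma poly_last_root (F : realFieldType) (p : {poly F}) (x : F) :
  p != 0 -> root p x ->
  exists y, [/\ x <= y, root p y & forall z, root p z -> z <= y].
Proof.
have [n] := ubnP (size p); elim: n p x => // n IHn p x le_p p0 px.
have [[z [pz xz]]|no] := pselect (exists z, root p z /\ x < z); last first.
  exists x; split=> // z pz; rewrite leNgt; apply/negP => xz.
  by apply: no; exists z.
(* Roots of p beyond x are roots of the quotient by X - x, whose size is smaller. *)
have /factor_theorem[q pE] := px.
have q0 : q != 0 by apply: contraNneq p0 => q0; rewrite pE q0 mul0r.
have qz : root q z.
  by move: pz; rewrite pE rootM root_XsubC (gt_eqF xz) orbF.
have [|y [zy qy ymax]] := IHn q z _ q0 qz.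
  by move: le_p; rewrite pE size_Mmonic ?monicXsubC // size_XsubC addn2.
have xy : x <= y := le_trans (ltW xz) zy.
exists y; split=> //; first by rewrite pE rootM qy.
by move=> t; rewrite pE rootM root_XsubC => /orP[/ymax|/eqP->].
Qed.

Lemma exists_scale_le (F : realFieldType) (T : finType) (w d : T -> F) :
  (forall i, 0 <= w i) -> (forall i, 0 < d i) ->
  exists2 r, 0 < r & forall i, r * w i <= d i.
Proof.
(* Adding 1 keeps the denominators positive where w vanishes. *)
move=> w0 d0; pose r := \big[Num.min/1]_i (d i / (w i + 1)).
have w1 i : 0 < w i + 1 by rewrite ltr_wpDl.
exists r; first by apply: lt_bigmin => // i _; rewrite divr_gt0.
move=> i; have ri : r * (w i + 1) <= d i.
  by rewrite -ler_pdivlMr //; apply: bigmin_inf (lexx _).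
apply: le_trans ri; rewrite ler_wpM2l ?lerDl //.
by apply/ltW/lt_bigmin => // j _; rewrite divr_gt0.
Qed.

Section Nonnegative.
Variables (F : rcfType) (n : nat) (A : 'M[F]_n).
Hypothesis A_ge0 : forall i j, 0 <= A i j.

(* For b constant, of the sign of det (t - A) on [t0, +oo[, the column
   x(t) = adj (t - A) b satisfies (t - A) x(t) > 0 there.  It is positive for
   large t, and at the last t where some coordinate x_k vanishes one would have
   0 = t x_k > (A x)_k >= 0. *)
Lemma exists_strictly_subinvariant (t0 : F) :
  (forall t, t0 <= t -> ~~ eigenvalue A t) ->
  exists2 u : 'I_n -> F, forall i, 0 < u i &
    forall i, \sum_j A i j * u j < t0 * u i.
Proof.
move=> no_eig; pose D := char_poly A.
have D_neq0 t : t0 <= t -> D.[t] != 0.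
  by move=> tt0; have := no_eig t tt0; rewrite eigenvalue_root_char.
have D_sign t : t0 <= t -> 0 < D.[t0] * D.[t].
  move=> tt0; rewrite ltNge; apply/negP => D0.
  have [|x /andP[tx _]] := @poly_ivt F (D.[t] *: D) t0 t tt0.
    by rewrite !hornerZ mulrC D0 -expr2 sqr_ge0.
  rewrite rootE hornerZ mulf_eq0 (negPf (D_neq0 _ tt0)) /=.
  by apply/negP/D_neq0.
have [x xE] : exists x : 'cV_n, char_poly_mx A *m x = const_mx (D.[t0] *: D).
  exists (\adj (char_poly_mx A) *m const_mx D.[t0]%:P).
  rewrite mulmxA mul_mx_adj mul_scalar_mx; apply/matrixP => i j.
  by rewrite !mxE mulrC mul_polyC.
pose X i : {poly F} := x i 0.
have XE t i : t * (X i).[t] = \sum_j A i j * (X j).[t] + D.[t0] * D.[t].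
  have := congr1 (fun M : 'cV_n => (M i 0).[t]) xE; rewrite /= !mxE hornerZ => <-.
  rewrite (bigD1 i) //= [X in _ = _ + X.[t]](bigD1 i) //= hornerD horner_sum.
  rewrite [X in _ = _ + (_ + X)](eq_bigr (fun j => - (A i j * (X j).[t]))).
    by rewrite sumrN /X !mxE eqxx !hornerE /=; ring.
  by move=> j ji; rewrite !mxE eq_sym (negPf ji) mulr0n !hornerE mulNr.
have [T tT XT] :
    exists2 T, t0 <= T & forall t i, T <= t -> 0 < (X i).[t].
  (* Past every row sum r_i, look at a minimal coordinate: (t - r_i) x_i >= D(t0) D(t) > 0. *)
  pose r i := \sum_j A i j.
  pose T := \big[Num.max/t0]_i (r i + 1).
  have tT : t0 <= T by apply: bigmax_ge_id.
  exists T => // t i0 Tt; have t0t := le_trans tT Tt.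
  have [i _ imin] := arg_minP (fun i => (X i).[t]) (erefl : xpredT i0).
  apply: lt_le_trans (imin i0 isT); rewrite ltNge; apply/negP => Xi0.
  have: r i * (X i).[t] <= \sum_j A i j * (X j).[t].
    rewrite /r mulr_suml; apply: ler_sum => j _.
    by apply: ler_wpM2l => //; apply: imin.
  rewrite -(lerD2r (D.[t0] * D.[t])) -XE -subr_ge0.
  rewrite opprD addrA -mulrBl; apply/negP; rewrite -ltNge subr_lt0.
  apply: le_lt_trans (D_sign _ t0t); apply: mulr_ge0_le0 => //.
  rewrite subr_ge0; apply: le_trans Tt; apply: le_trans (le_bigmax _ _ i).
  by rewrite lerDl.
exists (fun i => (X i).[t0]); last first.
  by move=> i; rewrite XE ltrDl D_sign.
suff noroot t : t0 <= t -> forall i, ~~ root (X i) t.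
  move=> i; rewrite ltNge; apply/negP => Xi.
  have [|y /andP[ty _]] := @poly_ivt F (X i) t0 T tT.
    by rewrite Xi ltW ?XT.
  exact/negP/noroot.
move=> tt0 i; apply/negP => Xit.
(* The last root of Q is the last point where some coordinate vanishes. *)
pose Q := \prod_j X j.
have QT : 0 < Q.[T] by rewrite horner_prod prodr_gt0 // => j _; apply: XT.
have Q0 : Q != 0 by apply: contraTneq QT => ->; rewrite horner0 ltxx.
have rootQ j z : root (X j) z -> root Q z.
  by move=> jz; rewrite /Q (bigD1 j) //= rootM jz.
have [y [ty Qy ymax]] := poly_last_root Q0 (rootQ _ _ Xit).
have t0y : t0 <= y := le_trans tt0 ty.
have [k Xky] : exists k, root (X k) y.
  have := Qy; rewrite rootE horner_prod => /prodf_eq0[k _ Xky].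
  by exists k; rewrite rootE.
have yT : y <= T.
  by rewrite leNgt; apply/negP => /ltW/(XT y k); rewrite (rootP Xky) ltxx.
have X_ge0 j : 0 <= (X j).[y].
  rewrite leNgt; apply/negP => Xj.
  have [|z /andP[yz _] Xjz] := @poly_ivt F (X j) y T yT.
    by rewrite !ltW // XT.
  have zy := ymax z (rootQ _ _ Xjz); have zy' : z = y by apply/le_anti/andP.
  by rewrite -zy' (rootP Xjz) ltxx in Xj.
have := XE y k; rewrite (rootP Xky) mulr0 => /eqP; rewrite lt_eqF //.
by apply: ltr_wpDl (D_sign _ t0y); apply: sumr_ge0 => j _; rewrite mulr_ge0.
Qed.

(** Irreducibility: a set of indices closed along the positive entries is empty or full. Below it is
    applied to zero sets. *)
Hypothesis A_irr : forall S : pred 'I_n,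
  (forall i j, S i -> 0 < A j i -> S j) -> forall i j, S i -> S j.

Let excess (y : 'I_n -> F) j := \sum_i y i * A i j - y j.

(* Replacing y by y + y A replaces the excess e by e + e A, whose support is
   strictly larger as long as it is not full. *)
Lemma exists_strictly_superinvariant (y : 'I_n -> F) :
  (forall i, 0 <= y i) -> (forall j, 0 <= excess y j) ->
  (exists j, excess y j != 0) ->
  exists2 w : 'I_n -> F, forall i, 0 <= w i & forall j, 0 < excess w j.
Proof.
pose Z (y : 'I_n -> F) := [pred j | excess y j == 0].
have [k] := ubnP #|Z y|; elim: k y => // k IHk y Zk y_ge0 ey_ge0 [j0 ey_j0].
have [full|] := boolP [forall j, excess y j != 0].
  by exists y => // j; rewrite lt_neqAle eq_sym (forallP full) ey_ge0.
rewrite negb_forall => /existsP[i0]; rewrite negbK => ey_i0.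
pose y' j := y j + \sum_i y i * A i j.
have ey' j : excess y' j = excess y j + \sum_i excess y i * A i j.
  under [X in _ = _ + X]eq_bigr do rewrite mulrBl.
  rewrite sumrB /excess /y'; under eq_bigr do rewrite mulrDl.
  by rewrite big_split /=; ring.
have eyA_ge0 j : 0 <= \sum_i excess y i * A i j.
  by apply: sumr_ge0 => i _; rewrite mulr_ge0.
have [[i [j [Zi Aji Zj]]]|no] := pselect (exists i j,
    [/\ excess y i == 0, 0 < A j i & excess y j != 0]).
- apply: (IHk y').
  + rewrite -ltnS; apply: leq_trans Zk; rewrite ltnS; apply/proper_card/properP.
    split; last first.
      exists i; rewrite !inE // ey' (eqP Zi) add0r psumr_eq0; last first.
        by move=> l _; rewrite mulr_ge0.
      apply/allPn; exists j; first by rewrite mem_index_enum.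
      by rewrite mulf_neq0 // gt_eqF.
    by apply/fintype.subsetP => l; rewrite !inE ey' paddr_eq0 // => /andP[].
  + by move=> l; rewrite addr_ge0 // sumr_ge0 // => m _; rewrite mulr_ge0.
  + by move=> l; rewrite ey' addr_ge0.
  + by exists j0; rewrite ey' paddr_eq0 // negb_and ey_j0.
(* Without such a pair the zero set is closed; containing i0 it would be full, against j0. *)
- have closedZ i j : Z y i -> 0 < A j i -> Z y j.
    by move=> Zi Aji; apply/negPn/negP => Zj; apply: no; exists i, j.
  by have := A_irr closedZ j0 ey_i0; rewrite /= (negPf ey_j0).
Qed.

(* If |y| A <> |y|, some w >= 0 has w A >= (1 + e) w, while A u < (1 + e) u for
   some u > 0; pairing w A with u gives a contradiction. *)
Lemma norm_left_fixed_vector (y : 'I_n -> F) :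
  (forall t, 1 < t -> ~~ eigenvalue A t) ->
  (forall j, \sum_i y i * A i j = y j) -> (exists i, y i != 0) ->
  (forall i, 0 < `|y i|) /\ (forall j, \sum_i `|y i| * A i j = `|y j|).
Proof.
move=> no_eig yA [i0 yi0]; pose v i := `|y i|.
have ev_ge0 j : 0 <= excess v j.
  rewrite subr_ge0 /v -{1}yA; apply: le_trans (ler_norm_sum _ _ _) _.
  by apply: ler_sum => i _; rewrite normrM (ger0_norm (A_ge0 _ _)).
have [ev_neq0|ev0] := pselect (exists j, excess v j != 0).
  have [w w_ge0 ew_gt0] :=
    exists_strictly_superinvariant (fun i => normr_ge0 (y i)) ev_ge0 ev_neq0.
  have [e e_gt0 we] := exists_scale_le w_ge0 ew_gt0.
  have [|u u_gt0 Au] := @exists_strictly_subinvariant (1 + e).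
    by move=> t te; apply: no_eig; apply: lt_le_trans te; rewrite ltrDl.
  have wA j : (1 + e) * w j <= \sum_i w i * A i j.
    by rewrite mulrDl mul1r addrC -lerBrDr.
  have: \sum_j (1 + e) * w j * u j <= \sum_i w i * (\sum_j A i j * u j).
    under [leRHS]eq_bigr do rewrite mulr_sumr.
    rewrite exchange_big /=; apply: ler_sum => j _.
    under eq_bigr do rewrite mulrA.
    by rewrite -mulr_suml ler_wpM2r // ltW.
  rewrite leNgt => /negP[].
  have [i wi] : exists i, 0 < w i.
    apply: contrapT => w0; have w00 i : w i = 0.
      apply/eqP; rewrite eq_le w_ge0 andbT leNgt; apply/negP => wi.
      by apply: w0; exists i.
    have := ew_gt0 i0; rewrite /excess w00 subr0 big1 ?ltxx // => i _.
    by rewrite w00 mul0r.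
  rewrite (bigD1 i) //= [ltRHS](bigD1 i) //= ltr_leD //.
    by rewrite -mulrA mulrCA ltr_pM2l.
  by apply: ler_sum => j _; rewrite -mulrA mulrCA ler_wpM2l // ltW.
have vA j : \sum_i v i * A i j = v j.
  apply/eqP; rewrite -subr_eq0; apply/negPn/negP => evj.
  by apply: ev0; exists j.
split=> // i; rewrite normr_gt0; apply/negP => yi.
(* As |y| A = |y|, the zero set of y is closed, so a single zero would force y = 0. *)
have closed_zero k l : y k == 0 -> 0 < A l k -> y l == 0.
  move=> /eqP yk Alk.
  have /eqP := vA k; rewrite {2}/v yk normr0 psumr_eq0; last first.
    by move=> m _; rewrite mulr_ge0 // normr_ge0.
  move=> /allP/(_ l (mem_index_enum _)).
  by rewrite mulf_eq0 normr_eq0 (gt_eqF Alk) orbF.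
by have := A_irr (S := fun i => y i == 0) closed_zero i0 yi; rewrite (negPf yi0).
Qed.
End Nonnegative.

(** * Spectral radius 1 and the Perron-Frobenius vector *)

Lemma spectral_radius1P n (P : 'M[rat]_n) : spectral_radius P = 1 ->
  (forall l : algC, eigenvalue (map_mx ratr P) l -> `|l| <= 1) /\
  (forall r : algC,
     (forall l : algC, eigenvalue (map_mx ratr P) l -> `|l| <= r) -> 1 <= r).
Proof.
rewrite /spectral_radius /supremum.
(* Both fallback values are 0, which differs from 1, so 1 is a genuine least upper bound. *)
set E := [set r | _]%classic; case: ifP => _ => [/eqP|].
  by rewrite eq_sym oner_eq0.
case: xgetP => [_ -> [ubE lbE] E1|_ /eqP]; last by rewrite eq_sym oner_eq0.
rewrite E1 in ubE lbE; split=> [l el|r r_ub]; first by apply: ubE; exists l.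
by apply: lbE => _ [l el <-]; apply: r_ub.
Qed.

(** It serves to rule out an empty alphabet and the default 0 of [production_matrix]. *)
Lemma spectral_radius_eq1_neq0 n (P : 'M[rat]_n) : spectral_radius P = 1 -> P != 0.
Proof.
move=> /spectral_radius1P[_ lub]; apply/eqP => P0.
suff : (1 : algC) <= 0 by rewrite ler10.
apply: lub => l /eigenvalueP[v]; rewrite P0 map_mx0 mulmx0 => /esym/eqP.
by rewrite scaler_eq0 => /orP[/eqP-> _|/eqP->]; rewrite ?normr0 ?eqxx.
Qed.

(** If 1 were not an eigenvalue, some u > 0 would satisfy P u <= (1 - e) u, bounding the modulus of
    every eigenvalue by 1 - e. So a rational fixed vector exists, and its entrywise absolute value
    is fixed and positive. *)
Lemma exists_pos_left_fixed_vector n (P : 'M[rat]_n) :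
  (forall i j, 0 <= P i j) ->
  (forall S : pred 'I_n,
     (forall i j, S i -> 0 < P j i -> S j) -> forall i j, S i -> S j) ->
  spectral_radius P = 1 ->
  exists2 v : 'I_n -> rat, forall i, 0 < v i &
    forall j, \sum_i v i * P i j = v j.
Proof.
move=> P_ge0 P_irr /spectral_radius1P[]; set PC : 'M[algC]_n := map_mx ratr P.
move=> eig_le1 lub.
pose A : 'M[algR]_n := map_mx ratr P.
have PCE : PC = map_mx algRval A.
  by apply/matrixP => i j; rewrite !mxE fmorph_rat.
have A_ge0 i j : 0 <= A i j by rewrite mxE ler0q.
have A_irr (S : pred 'I_n) :
    (forall i j, S i -> 0 < A j i -> S j) -> forall i j, S i -> S j.
  move=> closedS; apply: P_irr => i j Si Pji; apply: (closedS i) => //.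
  by rewrite mxE ltr0q.
have no_eig t : 1 < t -> ~~ eigenvalue A t.
  move=> t1; apply/negP => At.
  have : `|algRval t| <= 1 by apply: eig_le1; rewrite PCE eigenvalue_map.
  have t_gt1 : 1 < algRval t by exact: t1.
  by rewrite ger0_norm ?(ltW (lt_trans ltr01 _)) // lt_geF.
have eig1 : eigenvalue P 1.
  case: (boolP (eigenvalue P 1)) => // no_eig1; exfalso.
  have no_eig_ge1 t : 1 <= t -> ~~ eigenvalue A t.
    rewrite le_eqVlt => /orP[/eqP<-|]; last exact: no_eig.
    by rewrite -(rmorph1 ratr) eigenvalue_map.
  have [u u_gt0 Au] := exists_strictly_subinvariant A_ge0 no_eig_ge1.
  have [|e e_gt0 ue] := @exists_scale_le _ _ u
      (fun i => u i - \sum_j A i j * u j) (fun i => ltW (u_gt0 i)).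
    by move=> i; rewrite subr_gt0 -[ltRHS]mul1r.
  have e_gt0' : 0 < algRval e by exact: e_gt0.
  suff : (1 : algC) <= 1 - algRval e by rewrite lerDl oppr_ge0 lt_geF.
  apply: lub => l /eigenvalueP[y yP y0].
  pose U i := algRval (u i); have U_gt0 i : 0 < U i by exact: u_gt0.
  have PU i : \sum_j PC i j * U j <= (1 - algRval e) * U i.
    have -> : \sum_j PC i j * U j = algRval (\sum_j A i j * u j).
      by rewrite rmorph_sum; apply: eq_bigr => j _; rewrite rmorphM PCE mxE.
    have -> : (1 - algRval e) * U i = algRval ((1 - e) * u i).
      by rewrite rmorphM rmorphB rmorph1.
    suff : \sum_j A i j * u j <= (1 - e) * u i by [].
    by have := ue i; rewrite mulrBl mul1r lerBrDr addrC -lerBrDr.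
  have PC_ge0 i j : 0 <= PC i j by rewrite mxE ler0q.
  have ysum : 0 < \sum_i `|y 0 i| * U i.
    have /rV0Pn[i yi] := y0; rewrite (bigD1 i) //= ltr_pwDl //.
      by rewrite mulr_gt0 // normr_gt0.
    by apply: sumr_ge0 => j _; rewrite mulr_ge0 // ltW.
  (* Pair |y| with u: |l| (|y| u) <= |y| P u <= (1 - e) (|y| u). *)
  rewrite -(ler_pM2r ysum) !mulr_sumr.
  apply: (@le_trans _ _ (\sum_j \sum_i `|y 0 i| * PC i j * U j)).
    apply: ler_sum => j _; rewrite mulrA -normrM.
    have -> : l * y 0 j = (y *m PC) 0 j by rewrite yP mxE.
    rewrite mxE -mulr_suml ler_pM2r //; apply: le_trans (ler_norm_sum _ _ _) _.
    by apply: ler_sum => i _; rewrite normrM (ger0_norm (PC_ge0 _ _)).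
  rewrite exchange_big /=; apply: ler_sum => i _.
  under eq_bigr do rewrite -mulrA.
  by rewrite -mulr_sumr mulrCA ler_wpM2l.
have [y yP y0] := eigenvalueP eig1.
have yA j : \sum_i ratr (y 0 i) * A i j = ratr (y 0 j).
  have := congr1 (fun M : 'rV_n => ratr (M 0 j) : algR) yP.
  rewrite /= scale1r mxE rmorph_sum => <-.
  by apply: eq_bigr => i _; rewrite mxE -rmorphM.
have yA0 : exists i, ratr (y 0 i) != 0 :> algR.
  by have /rV0Pn[i yi] := y0; exists i; rewrite fmorph_eq0.
have [v_gt0 vA] := norm_left_fixed_vector A_ge0 A_irr no_eig yA yA0.
exists (fun i => `|y 0 i|) => [i|j].
  by have := v_gt0 i; rewrite -ratr_norm ltr0q.
apply: (fmorph_inj (ratr : {rmorphism rat -> algR})).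
rewrite /= ratr_norm -vA rmorph_sum; apply: eq_bigr => i _.
by rewrite rmorphM /= ratr_norm mxE.
Qed.

(** * Idempotent iterates, integer scaling and suprema of integers *)

Lemma exists_idempotent_iter (T : finType) (f : T -> T) :
  exists2 m, (0 < m)%N & forall x, iter m f (iter m f x) = iter m f x.
Proof.
pose g (k : 'I_#|{ffun T -> T}|.+1) := [ffun x => iter k f x].
have /injectivePn[i [j ij gij]] : ~~ injectiveb g.
  by apply/negP => /injectiveP/leq_card; rewrite card_ord ltnn.
wlog lt_ij : i j ij gij / (i < j)%N => [hw|].
  have := ij; rewrite -val_eqE neq_ltn => /orP[] lt_ij; first exact: (hw i j).
  by apply: (hw j i) => //; rewrite eq_sym.
have per k x : (i <= k)%N -> iter (k + (j - i)) f x = iter k f x.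
  move=> ik; rewrite -(subnK ik) -addnA subnKC ?(ltnW lt_ij) // !iterD.
  by have /ffunP/(_ x) := gij; rewrite !ffunE => ->.
have perM l k x : (i <= k)%N -> iter (k + l * (j - i)) f x = iter k f x.
  move=> ik; elim: l => [|l IHl]; first by rewrite addn0.
  by rewrite mulSnr addnA per ?IHl // (leq_trans ik) ?leq_addr.
have ji : (0 < j - i)%N by rewrite subn_gt0.
(* A multiple of the period that is at least i is an idempotent exponent; the successor keeps it
   positive when i = 0. *)
exists (i.+1 * (j - i))%N => [|x]; first by rewrite muln_gt0.
by rewrite -iterD perM // (leq_trans (leqnSn i)) // leq_pmulr.
Qed.

(** Clear denominators by their product, then divide by the gcd; the given point of T makes that gcd
    nonzero. *)
Lemma exists_primitive_scaling (T : finType) (v : T -> rat) :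
  T -> (forall a, 0 < v a) ->
  exists (s : {ffun T -> nat}) (c : rat),
    [/\ forall a, (0 < s a)%N, forall a, (s a)%:R = c * v a
      & (\big[gcdn/0]_a s a)%N = 1%N].
Proof.
move=> a0 v_gt0; pose d a : nat := `|denq (v a)|%N.
have dE a : (d a)%:R = (denq (v a))%:~R :> rat.
  by rewrite /d -[RHS]ger0_norm ?ler0z ?denq_ge0 // -intr_norm -abszE.
have d_gt0 a : (0 < d a)%N by rewrite absz_gt0 denq_neq0.
pose m a := (`|numq (v a)| * \prod_(b | b != a) d b)%N.
have m_gt0 a : (0 < m a)%N.
  by rewrite muln_gt0 absz_gt0 numq_eq0 gt_eqF ?v_gt0 //= prodn_gt0.
have mE a : (m a)%:R = (\prod_b d b)%:R * v a.
  rewrite (bigD1 a) //= !natrM mulrAC dE; congr (_ * _).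
  rewrite -[X in _ * X]divq_num_den mulrC divfK ?intr_eq0 ?denq_neq0 //.
  rewrite -[RHS]ger0_norm -?intr_norm -?abszE //.
  by rewrite ler0z numq_ge0 ltW.
pose g := (\big[gcdn/0]_a m a)%N.
have gm a : (g %| m a)%N by rewrite /g (bigD1 a) //= dvdn_gcdl.
have g_gt0 : (0 < g)%N by rewrite (dvdn_gt0 (m_gt0 a0)).
exists [ffun a => m a %/ g]%N, ((\prod_b d b)%:R / g%:R); split.
- by move=> a; rewrite ffunE divn_gt0 // dvdn_leq.
- move=> a; rewrite ffunE mulrAC -mE -{2}(divnK (gm a)) natrM mulfK //.
  by rewrite pnatr_eq0 -lt0n.
apply/eqP; rewrite -(eqn_pmul2r g_gt0) mul1n.
rewrite (big_morph (muln^~ g) (fun x y => muln_gcdl x y g) (mul0n g)).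
by rewrite /g; apply/eqP/eq_bigr => a _; rewrite ffunE divnK.
Qed.

(** This keeps [supremum] from falling back to its default. If M bounds E, then M - k can bound E
    only for k <= M - x, and the largest such k gives the least bound. *)
Lemma supremums_ereal_int_neq0 (E : set (\bar int)) (x : int) :
  E x%:E -> (supremums E !=set0)%classic.
Proof.
move=> Ex; have ub_x u : ubound E u -> (x%:E <= u)%E by apply.
have [[M ubM]|noub] := pselect (exists M : int, ubound E M%:E); last first.
  exists +oo%E; split=> [y _|u ubu]; first exact: leey.
  case: u ubu => [M|//|] ubu; first by case: noub; exists M.
  by have := ub_x _ ubu.
pose p k := `[< ubound E (M - k%:Z)%:E >].
have p0 : exists k, p k by exists 0%N; apply/asboolP; rewrite subr0.
have p_bound k : p k -> (k <= `|M - x|)%N.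
  move=> /asboolP/ub_x; rewrite lee_fin => xk.
  by rewrite -lez_nat (le_trans _ (ler_norm _)) // lerBrDr addrC -lerBrDr.
case: (ex_maxnP p0 p_bound) => k /asboolP ubk kmax.
exists (M - k%:Z)%:E; split=> // u ubu.
case: u ubu => [u|_|ubu]; [|exact: leey|by have := ub_x _ ubu].
move=> ubu; rewrite lee_fin leNgt; apply/negP => uk.
have uM : u <= M by apply: ltW; apply: lt_le_trans uk _; rewrite gerBl.
have /kmax : p `|M - u|%N.
  by apply/asboolP; rewrite gez0_abs ?subr_ge0 // subKr.
rewrite -lez_nat gez0_abs ?subr_ge0 // lerBlDr -lerBlDl.
by rewrite leNgt uk.
Qed.

(** * Locally recurrent states and the production matrix *)

Section Network.
Variable N : finite_abelian_network.
Implicit Types (a b c d : letter N) (q : state N) (m : nat).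

Local Notation P := (production_matrix N).

Lemma inhabited_state : inhabited (state N).
Proof.
pose q_ v := enum_val (Ordinal (@local_state_gt0 N v)).
constructor; exact: (finfun q_).
Qed.

Lemma step_word_nseq m a q : step_word (nseq m a) q = iter m (step a) q.
Proof. by elim: m q => // m IHm q; rewrite iterSr -IHm. Qed.

Lemma msg_word_nseq m a q b :
  msg_word (nseq m a) q b = (\sum_(i < m) step_msg a (iter i (step a) q) b)%N.
Proof.
elim: m q => [|m IHm] q; first by rewrite big_ord0 ffunE.
rewrite msg_word_cons IHm big_ord_recl; congr (_ + _)%N.
by apply: eq_bigr => i _; rewrite -iterSr.
Qed.

Lemma word_of_single m a :
  perm_eq (word_of [ffun b => m * (b == a)]%N) (nseq m a).
Proof.
apply/allP => b _ /=; rewrite count_word_of ffunE count_nseq /= mulnC.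
by rewrite (eq_sym b).
Qed.

Lemma transition_monoid_iter m a :
  [ffun q => iter m (step a) q] \in transition_monoid N.
Proof.
apply/bigcapP => S /andP[/andP[idS /forallP compS] /forallP stepS].
elim: m => [|m IHm]; first exact: idS.
have /forallP/(_ [ffun q => iter m (step a) q])/implyP/(_ IHm) :=
  implyP (compS _) (stepS a).
by congr (_ \in S); apply/ffunP => q; rewrite !ffunE.
Qed.

Lemma transition_monoidC f a q :
  f \in transition_monoid N -> f (step a q) = step a (f q).
Proof.
(* The maps commuting with all steps form a submonoid containing the generators. *)
pose S := [set f : {ffun state N -> state N} |
           [forall a, forall q, f (step a q) == step a (f q)]].
suff sub : transition_monoid N \subset S.
  by move=> /(fintype.subsetP sub); rewrite inE => /forallP/(_ a)/forallP/(_ q)/eqP.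
apply: finset.bigcap_inf; apply/andP; split; [apply/andP; split|].
- by rewrite inE; apply/forallP => b; apply/forallP => r; rewrite !ffunE.
- apply/forallP => g; apply/implyP; rewrite inE => /forallP gS.
  apply/forallP => h; apply/implyP; rewrite !inE => /forallP hS.
  apply/forallP => b; apply/forallP => r; rewrite !ffunE.
  by rewrite (eqP (forallP (hS b) r)) (eqP (forallP (gS b) _)).
- apply/forallP => b; rewrite inE; apply/forallP => c; apply/forallP => r.
  by rewrite !ffunE stepC.
Qed.

(* An idempotent power of [step a] is one of the factors of [max_idempotent]. *)
Lemma Loc_periodic a :
  exists2 m, (0 < m)%N & {in Loc N, forall q, iter m (step a) q = q}.
Proof.
have [m m_gt0 idem] := exists_idempotent_iter (@step N a).
exists m => // q /imsetP[q0 _ ->]; rewrite /max_idempotent.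
pose g : {ffun state N -> state N} := [ffun q => iter m (step a) q].
have gTM : g \in transition_monoid N by apply: transition_monoid_iter.
have g_idem : endo_comp g g == g by apply/eqP/ffunP => r; rewrite !ffunE idem.
have fC f r : f \in transition_monoid N ->
    iter m (step a) (f r) = f (iter m (step a) r).
  move=> fTM; elim: m {idem g gTM g_idem m_gt0} => //= k ->.
  by rewrite transition_monoidC.
have : g \in index_enum {ffun state N -> state N} by rewrite mem_index_enum.
(* A factor equal to g absorbs the power of [step a] by idempotence; past any other factor the power
   commutes. *)
elim: (index_enum _) => // f r IHr; rewrite inE big_cons => gfr.
case: ifP => [/andP[fTM f_idem]|fN].
  rewrite ffunE; case/predU1P: gfr => [<-|/IHr grE].
    by rewrite !ffunE idem.
  by rewrite fC ?grE.
case/predU1P: gfr => [gf|/IHr //].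
by move: fN; rewrite -gf gTM g_idem.
Qed.

Hypothesis N_critical : critical N.

Lemma critical_letter : inhabited (letter N).
Proof.
apply: contrapT => no_letter; move/spectral_radius_eq1_neq0/eqP: N_critical; apply.
by apply/matrixP => i; case: no_letter; exact: (inhabits (enum_val i)).
Qed.

(** P is nonzero, hence it is not the default returned by [xget]. *)
Lemma critical_production_matrixP : is_production_matrix P.
Proof.
have := spectral_radius_eq1_neq0 N_critical.
by rewrite /production_matrix; case: xgetP => [_ -> //|_]; rewrite eqxx.
Qed.

(** Since t_a^m fixes [Loc] pointwise, m|a| lies in the kernel, and P applied to it sums the
    messages along the cycle of t_a. *)
Lemma production_matrix_column a :
  exists2 m, (0 < m)%N & {in Loc N, forall q b,
    entry P b a * m%:R =
      \sum_(i < m) (step_msg a (iter i (step a) q) b)%:R}.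
Proof.
have [m m_gt0 per] := Loc_periodic a; exists m => // q Lq b.
pose k : {ffun letter N -> nat} := [ffun b => m * (b == a)]%N.
have kK : in_kernel [ffun a => (k a)%:Z].
  move=> r Lr; have -> : pos_part [ffun a => (k a)%:Z] = k.
    by apply/ffunP => c; rewrite !ffunE max_l.
  have -> : neg_part [ffun a => (k a)%:Z] = [ffun=> 0%N].
    by apply/ffunP => c; rewrite !ffunE max_r // oppr_le0.
  rewrite /step_vec (step_word_perm _ (word_of_single m a)) step_word_nseq per //.
  rewrite (@step_word_perm _ _ [::]) //.
  by apply/allP => c _ /=; rewrite count_word_of ffunE.
have := critical_production_matrixP kK Lq b.
rewrite /msg_vec (msg_word_perm _ (word_of_single m a)) msg_word_nseq.
rewrite natr_sum => <-; rewrite (bigD1 a) //= big1 => [|c ca].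
  by rewrite ffunE eqxx muln1 addr0.
by rewrite ffunE (negPf ca) muln0 mulr0.
Qed.

Lemma exists_Loc : exists q, q \in Loc N.
Proof.
by have [q] := inhabited_state; exists (max_idempotent N q); apply: imset_f.
Qed.

Lemma entry_ge0 b a : 0 <= entry P b a.
Proof.
have [m m_gt0 col] := production_matrix_column a.
have [q /col/(_ b) Pm] := exists_Loc.
rewrite -(pmulr_lge0 _ (_ : 0 < m%:R)) ?ltr0n // Pm.
by apply: sumr_ge0 => i _; rewrite ler0n.
Qed.

Lemma entry_gt0_message b a : 0 < entry P b a ->
  exists q, (0 < step_msg a q b)%N.
Proof.
have [m m_gt0 col] := production_matrix_column a.
have [q0 Lq0] := exists_Loc; have Pm := col _ Lq0 b.
rewrite -(pmulr_lgt0 _ (_ : 0 < m%:R)) ?ltr0n // Pm => pos.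
have [[i i_gt0]|none] :=
    pselect (exists i : 'I_m, (0 < step_msg a (iter i (step a) q0) b)%N).
  by exists (iter i (step a) q0).
move: pos; rewrite big1 ?ltxx // => i _; apply/eqP.
rewrite pnatr_eq0 -leqn0 leqNgt; apply/negP => i_gt0.
by apply: none; exists i.
Qed.

(** * Exchange rates *)

Hypothesis N_connected : strongly_connected N.

Lemma strongly_connected_closed (S : pred (letter N)) :
  (forall c d, S c -> 0 < entry P d c -> S d) -> forall a b, S a -> S b.
Proof.
move=> closedS a b; have /connectP[p + ->] := N_connected a b.
by elim: p a => // c p IHp a /= /andP[ac /IHp{IHp}] H Sa; apply/H/(closedS a).
Qed.

(** Both directions obtain s = 1 from this: the minimizers of s are closed along edges, so s is
    constant, and its gcd is 1. *)
Lemma exchange_rate_eq1 (s : {ffun letter N -> nat}) : is_exchange_rate s ->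
  (forall c d, (forall b, s c <= s b)%N -> 0 < entry P d c -> s d = s c) ->
  forall a, s a = 1%N.
Proof.
move=> [_ _ gcd1] spread; have [a0] := critical_letter.
have [c _ cmin] := arg_minnP s (erefl : xpredT a0).
have sc a : s a = s c.
  apply/eqP; apply: (@strongly_connected_closed (fun a => s a == s c) _ c) => //.
  move=> b d /eqP sb Pdb; rewrite (spread b) ?sb // => e.
  exact: cmin.
suff c1 : s c = 1%N by move=> a; rewrite sc.
apply/eqP; rewrite -dvdn1 -gcd1.
elim/big_rec: _ => [|a x _ sx]; first exact: dvdn0.
by rewrite dvdn_gcd sx sc dvdnn.
Qed.

(** The Perron-Frobenius vector, scaled to coprime integers, gives [xget] something to select. *)
Lemma exchange_rateP : is_exchange_rate (exchange_rate N).
Proof.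
have [||v v_gt0 vP] := @exists_pos_left_fixed_vector _ P _ _ N_critical.
- move=> i j; rewrite -(enum_valK i) -(enum_valK j); exact: entry_ge0.
- move=> S closedS i j Si; rewrite -(enum_valK j).
  apply: (@strongly_connected_closed (fun a => S (enum_rank a)) _ (enum_val i)).
    by move=> c d; apply: closedS.
  by rewrite enum_valK.
have [a0] := critical_letter.
have [s [c [s_gt0 sE gcd1]]] :=
  exists_primitive_scaling a0 (fun a : letter N => v_gt0 (enum_rank a)).
apply: (@xgetI _ _ [set s | is_exchange_rate s]%classic s).
split=> // a; rewrite sE -vP mulr_sumr.
rewrite [RHS](reindex (@enum_rank (letter N))) /=; last first.
  exact/onW_bij/enum_rank_bij.
by apply: eq_bigr => b _; rewrite sE mulrA.
Qed.

Local Notation s := (exchange_rate N).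

(** The cancellation along a cycle of t_a: s^T P = s^T is combined with the formula for column a of
    P. *)
Lemma sum_mul_step_msg_period a q : q \in Loc N ->
  exists2 m, (0 < m)%N &
    (\sum_(i < m) \sum_b s b * step_msg a (iter i (step a) q) b = m * s a)%N.
Proof.
move=> Lq; have [m m_gt0 /(_ q Lq) Pm] := production_matrix_column a.
exists m => //; apply/eqP; rewrite -(eqr_nat rat) natrM.
have [_ <- _] := exchange_rateP; rewrite mulr_sumr natr_sum.
under eq_bigr do rewrite natr_sum.
rewrite exchange_big /=; apply/eqP/eq_bigr => b _.
rewrite mulrCA [m%:R * _]mulrC Pm mulr_sumr.
by apply: eq_bigr => i _; rewrite natrM.
Qed.

Lemma agent_exchange_rate : agent_network N -> forall a, s a = 1%N.
Proof.
move=> agent; have sP := exchange_rateP; apply: exchange_rate_eq1 => // c d cmin Pdc.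
have col1 : \sum_b entry P b c = 1.
  have [m m_gt0 col] := production_matrix_column c.
  have [q Lq] := exists_Loc; have Pm := col _ Lq.
  have m0 : m%:R != 0 :> rat by rewrite pnatr_eq0 -lt0n.
  apply: (mulIf m0); rewrite mulr_suml; under eq_bigr do rewrite Pm.
  rewrite exchange_big /= mul1r -[in RHS](card_ord m) -sum1_card natr_sum.
  by apply: eq_bigr => i _; rewrite -natr_sum agent.
have [_ /(_ c) sc _] := sP.
(* The terms sum to 0 because column c of P sums to 1; they are nonnegative because s(c) is minimal,
   so each vanishes. *)
have : \sum_b ((s b)%:R - (s c)%:R) * entry P b c = 0.
  under eq_bigr do rewrite mulrBl.
  by rewrite sumrB sc -mulr_sumr col1 mulr1 subrr.
move/eqP; rewrite psumr_eq0 => [/allP/(_ d (mem_index_enum _))|b _].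
  by rewrite mulf_eq0 (gt_eqF Pdc) orbF subr_eq0 eqr_nat => /eqP.
by rewrite mulr_ge0 ?entry_ge0 // subr_ge0 ler_nat.
Qed.

(** * Agent networks have capacity 0 *)

Lemma agent_fire_word_sum (w : seq (letter N)) (x : config N) :
  agent_network N -> \sum_a (fire_word w x).1 a = \sum_a x.1 a.
Proof.
move=> agent; elim: w x => //= a w IHw x; rewrite IHw /=.
under eq_bigr do rewrite ffunE.
rewrite sumrB big_split /= -(big_morph Posz PoszD (erefl _)) agent.
rewrite [X in _ - X](bigD1 a) //= eqxx [X in _ - (_ + X)]big1 => [|b /negPf->] //.
by rewrite addr0 addrK.
Qed.

Lemma agent_capacity : agent_network N -> capacity N = 0%:E.
Proof.
move=> agent; have s1 := agent_exchange_rate agent.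
have cap0 q : state_capacity q = 0%:E.
  rewrite /state_capacity; set E := image _ _.
  (* The zero configuration halts at once, so the value 0 is attained. *)
  have E0 : E 0%:E.
    exists [ffun=> 0] => /=; last by rewrite big1 // => a _; rewrite ffunE mulr0.
    exists ([ffun=> 0], q); first by exists [::].
    by move=> a; rewrite ffunE.
  rewrite /supremum; case: ifP => [/eqP EE|_]; first by rewrite EE in E0.
  apply: xget_subset1; last exact: is_subset1_supremums.
  split=> [_ [z [_ [w _ <-] z'_le0] <-]|u]; last exact.
  rewrite lee_fin; under eq_bigr do rewrite s1 mul1r.
  rewrite -(agent_fire_word_sum w (z, q) agent).
  by apply: sumr_le0 => a _; apply: z'_le0.
have [q0] := inhabited_state.
rewrite /capacity; apply/le_anti/andP; split.
  by apply: bigmax_le => [|q _]; [exact: leNye|rewrite cap0].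
by rewrite -(cap0 q0); apply: le_bigmax.
Qed.

(** * Capacity 0 forces an agent network *)

Lemma capacity0_halts q (z : {ffun letter N -> int}) :
  capacity N = 0%:E -> halts (z, q) -> \sum_a (s a)%:Z * z a <= 0.
Proof.
move=> cap0 zq; have : (state_capacity q <= 0%:E)%E.
  by rewrite -cap0; apply: le_bigmax.
rewrite /state_capacity; set E := image _ _.
have Ez : E (\sum_a (s a)%:Z * z a)%:E by exists z.
move=> supE; rewrite -lee_fin; apply: le_trans supE.
(* The set of weights has a supremum, so [supremum] is a true upper bound. *)
exact/ge_supremum_Nmem/Ez/supremums_ereal_int_neq0/Ez.
Qed.

(* If firing [a] in state [q] lost weight, it would produce no [a] at all, so
   [|a| - M_a(q)] would halt in a single step although its weight is positive. *)
Lemma capacity0_step_msg_ge a q :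
  capacity N = 0%:E -> (s a <= \sum_b s b * step_msg a q b)%N.
Proof.
move=> cap0; rewrite leqNgt; apply/negP => loss.
have [s_gt0 _ _] := exchange_rateP.
(* A single emitted a would already carry the weight s(a). *)
have no_a : step_msg a q a = 0%N.
  apply/eqP; rewrite -leqn0 leqNgt; apply/negP => msg_a; move: loss.
  by rewrite ltnNge (bigD1 a) //= (leq_trans _ (leq_addr _ _)) // leq_pmulr.
pose z : {ffun letter N -> int} := [ffun b => (b == a)%:Z - (step_msg a q b)%:Z].
have : halts (z, q).
  exists (fire a (z, q)).
    by exists [:: a] => //=; rewrite ffunE eqxx no_a.
  by move=> b; rewrite /= !ffunE subrK subrr.
move/(capacity0_halts cap0); apply/negP; rewrite -ltNge.
under eq_bigr do rewrite ffunE mulrBr.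
rewrite sumrB subr_gt0 [ltRHS](bigD1 a) //= eqxx mulr1.
rewrite [X in _ < _ + X]big1 ?addr0 => [|b /negPf->]; last by rewrite mulr0.
under eq_bigr do rewrite -PoszM.
by rewrite -(big_morph Posz PoszD (erefl _)) ltz_nat.
Qed.

Lemma capacity0_agent :
  capacity N = 0%:E -> (forall q, q \in Loc N) -> agent_network N.
Proof.
move=> cap0 all_Loc; have [s_gt0 _ _] := exchange_rateP.
(* Over a cycle of t_a the produced weight is m s(a) and no term is below s(a), so none exceeds it;
   the first term belongs to q. *)
have balance a q : (\sum_b s b * step_msg a q b = s a)%N.
  have [[//|m] _ sum_m] := sum_mul_step_msg_period a (all_Loc q).
  apply/eqP; rewrite eqn_leq capacity0_step_msg_ge // andbT.
  rewrite leqNgt; apply/negP => gain.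
  have : (\sum_(i < m.+1) s a < m.+1 * s a)%N.
    rewrite -sum_m !big_ord_recl /= -addSn leq_add //.
    by apply: leq_sum => i _; apply: capacity0_step_msg_ge.
  by rewrite sum_nat_const card_ord ltnn.
have s1 : forall a, s a = 1%N.
  apply: (exchange_rate_eq1 exchange_rateP) => c d cmin /entry_gt0_message[q msg_d].
  (* By the balance, a letter d emitted by c weighs at most s(c), the minimum. *)
  apply/eqP; rewrite eqn_leq cmin andbT -(balance c q) (bigD1 d) //=.
  by rewrite (leq_trans _ (leq_addr _ _)) // leq_pmulr.
by move=> a q; have := balance a q; under eq_bigr do rewrite s1 mul1n; rewrite s1.
Qed.

End Network.

Theorem lemma7p8 (N : finite_abelian_network)
    (N_irreducible : locally_irreducible N)
    (N_connected : strongly_connected N)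
    (N_critical : critical N) :
  (agent_network N -> capacity N = 0%R%:E) /\
  (capacity N = 0%R%:E -> (forall q : state N, q \in Loc N) -> agent_network N).
Proof.
by split; [apply: agent_capacity|apply: capacity0_agent].
Qed.
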